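(* Let $\gamma_0$ and $\gamma_1$ be two homotopic paths in a $7$-connected domain $U$ in the octonion algebra $\mathbf O$, and let $\{\gamma_p:p\in[0,1]\}$ be a family of paths realizing the homotopy. Suppose that an analytic element $F$ has an analytic extension along each path $\gamma_p$, $p\in[0,1]$. Then all results of extensions of $F$ along $\gamma_0$ and $\gamma_1$ coincide.
   Context: A domain is an open connected set; it is $7$-connected if it is arcwise connected with trivial homotopy groups $\pi_k$ for $1\le k\le7$. A (canonical, analytic) element is a pair $F=(B,f)$, where $B=\{z\in\mathbf O:|z-z_0|<r\}$ is the maximal open ball on which $f$ has a convergent power series expansion with centre $z_0$: $f(z)=\sum_k\{b_{k,1}(z-z_0)^{k_1}\cdots b_{k,m}(z-z_0)^{k_m}\}_{q(2|k|)}$, with $k=(k_1,\dots,k_m)$, $0\le k_j\in\mathbf Z$, $m=m(k)\in\mathbf N$, $b_{k,j}\in\mathbf O$, and $q(2|k|)$ indicating the order of brackets (multiplications). The point $z_0$ is the centre of $F$ and $B$ its ball. Two elements $F=(B,f)$, $G=(C,g)$ are immediate analytic extensions of each other if $W=B\cap C\neq\emptyset$ and $f|_W=g|_W$. A canonical element $F_0=(B_0,f_0)$ is extendible along a path $\psi:[0,1]\to\mathbf O$, where the centre of $F_0$ is $z_0=\psi(0)$, if there exists a family of elements $F_t=(B_t,f_t)$, $t\in[0,1]$, with centres $z_t=\psi(t)$ and nonzero radii $r_t$, such that whenever an open segment $(\alpha,\beta)$ satisfies $t_0\in(\alpha,\beta)\subset[0,1]$ and $\psi(\alpha,\beta)\subset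 B_{t_0}$, then for each $t\in(\alpha,\beta)$ the element $F_t$ is the immediate extension of $F_{t_0}$. The result of the extension along $\psi$ is $F_1$.
   Formalization: In the definition of extension along a path, open segments (α,β) are taken relatively open in [0,1], so they may contain 0 or 1; with segments (α,β)⊂[0,1] read literally, the end elements F_0 and F_1 would be unconstrained and the claim false. *)

(* Defs.v *)
From HB Require Import structures.
From mathcomp Require Import all_boot all_order all_algebra finmap.
From mathcomp Require Import all_classical all_reals all_analysis.
From mathcomp Require summability.

Set Implicit Arguments.
Unset Strict Implicit.
Unset Printing Implicit Defensive.

Import Order.TTheory GRing.Theory Num.Theory.
Import numFieldNormedType.Exports.

Local Open Scope classical_set_scope.
Local Open Scope ring_scope.

(* Cayley-Dickson doubling of an algebra A with conjugation cj and product ml: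
   (a + b l) (c + d l) = (a c - d^* b) + (d a + b c^* ) l. *)
Definition cd_conj (A : zmodType) (cj : A -> A) (x : A * A) : A * A :=
  (cj x.1, - x.2).

Definition cd_mul (A : zmodType) (cj : A -> A) (ml : A -> A -> A)
    (x y : A * A) : A * A :=
  (ml x.1 y.1 - ml (cj y.2) x.2, ml y.2 x.1 + ml x.2 (cj y.1)).

Definition cplx (R : realType) := (R * R)%type.
Definition quat (R : realType) := (cplx R * cplx R)%type.
(* Only the additive and topological structures that oct R inherits as a product
   type are the intended ones: the inherited ring product is componentwise (use
   omul), and the inherited norm is a sup norm (use onorm). *)
Definition oct (R : realType) := (quat R * quat R)%type.

Definition cplx_conj (R : realType) : cplx R -> cplx R :=
  @cd_conj R idfun.
Definition cplx_mul (R : realType) : cplx R -> cplx R -> cplx R :=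
  @cd_mul R idfun *%R.
Definition quat_conj (R : realType) : quat R -> quat R :=
  @cd_conj (cplx R) (@cplx_conj R).
Definition quat_mul (R : realType) : quat R -> quat R -> quat R :=
  @cd_mul (cplx R) (@cplx_conj R) (@cplx_mul R).
Definition omul (R : realType) : oct R -> oct R -> oct R :=
  @cd_mul (quat R) (@quat_conj R) (@quat_mul R).

Definition oone (R : realType) : oct R := (((1, 0), (0, 0)), ((0, 0), (0, 0))).

(* Octonions are power-associative, so the side of the iteration is immaterial. *)
Definition opow (R : realType) (z : oct R) (n : nat) : oct R :=
  iter n (omul z) (oone R).

Definition cd_sqnorm (R : realType) (A : Type) (sq : A -> R) (x : A * A) : R :=
  sq x.1 + sq x.2.

(* Euclidean norm of R^8. *)
Definition onorm (R : realType) (z : oct R) : R :=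
  Num.sqrt (cd_sqnorm (cd_sqnorm (cd_sqnorm (fun x : R => x ^+ 2))) z).

(* The radius may be +oo, in which case the ball is the whole algebra. *)
Definition oball (R : realType) (z0 : oct R) (r : \bar R) : set (oct R) :=
  [set z | ((onorm (z - z0))%:E < r)%E].

(* Order of multiplications in a product of n factors: a binary tree with n
   leaves. *)
Inductive bracketing : Type :=
| Leaf
| Node of bracketing & bracketing.

Fixpoint leaves (t : bracketing) : nat :=
  if t is Node l r then (leaves l + leaves r)%N else 1%N.

(* The product of the sequence s bracketed along t, for size s = leaves t. *)
Fixpoint bprod (R : realType) (t : bracketing) (s : seq (oct R)) : oct R :=
  if t is Node l r then
    omul (bprod l (take (leaves l) s)) (bprod r (drop (leaves l) s))
  else head (oone R) s.

(* Multi-indices k = (k_1, ..., k_m) of arbitrary length m = m(k) >= 1. *)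
Definition multiindex := {k : seq nat | (0 < size k)%N}.

(* The coefficient b_{k,j} is pscoef k (j-1). The term of index k has the 2m(k)
   factors b_{k,1}, z^{k_1}, ..., b_{k,m}, z^{k_m}; a product that has
   fewer coefficients or splits a power is obtained by taking b_{k,j} = 1. *)
Record opseries (R : realType) := OPSeries {
  pscoef : multiindex -> nat -> oct R;
  psbracket : multiindex -> bracketing;
  _ : forall k, leaves (psbracket k) = (2 * size (val k))%N
}.

Definition psterm (R : realType) (S : opseries R) (w : oct R) (k : multiindex) :
    oct R :=
  bprod (psbracket S k)
    (flatten [seq [:: pscoef S k j; opow w (nth 0%N (val k) j)]
             | j <- iota 0 (size (val k))]).

(* The multi-indices carry no canonical order: the series is summed along the
   directed set of finite sets of multi-indices. *)
Definition has_expansion (R : realType) (f : oct R -> oct R) (z0 : oct R)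
    (r : \bar R) : Prop :=
  exists S : opseries R, forall z, oball z0 r z ->
    summability.partial_sum (psterm S (z - z0)) B
      @[B --> summability.totally] --> f z.

(* Maximality is over all balls with centre z0, all expansions, and all
   extensions of f from its ball. *)
Definition canonical_element (R : realType) (z0 : oct R) (r : \bar R)
    (f : oct R -> oct R) : Prop :=
  [/\ (0 < r)%E,
      has_expansion f z0 r
    & forall (r' : \bar R) (g : oct R -> oct R), (r < r')%E ->
        (forall z, oball z0 r z -> g z = f z) -> ~ has_expansion g z0 r'].

(* Only the values of elfun on the ball are meaningful: elements are compared
   by same_element, not by Leibniz equality. *)
Record element (R : realType) := Element {
  elcentre : oct R;
  elradius : \bar R;
  elfun : oct R -> oct R;
  _ : canonical_element elcentre elradius elfun
}.

Definition elball (R : realType) (F : element R) : set (oct R) :=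
  oball (elcentre F) (elradius F).

Definition same_element (R : realType) (F G : element R) : Prop :=
  [/\ elcentre F = elcentre G,
      elball F = elball G
    & forall z, elball F z -> elfun F z = elfun G z].

Definition immediate_extension (R : realType) (F G : element R) : Prop :=
  elball F `&` elball G !=set0 /\
  forall z, (elball F `&` elball G) z -> elfun F z = elfun G z.

(* Open segments of [0,1] are relatively open, i.e. of the form
   ]a,b[ `&` [0,1], so that the end points of [0,1] are not isolated from the
   rest of the family. *)
Definition extension_along (R : realType) (psi : R -> oct R) (F : element R)
    (Ft : R -> element R) : Prop :=
  [/\ same_element F (Ft 0),
      forall t, `[0, 1]%classic t -> elcentre (Ft t) = psi t
    & forall a b t0 : R, (`]a, b[ `&` `[0, 1]) t0 ->
        (forall t, (`]a, b[ `&` `[0, 1]) t -> elball (Ft t0) (psi t)) ->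
        forall t, (`]a, b[ `&` `[0, 1]) t ->
          immediate_extension (Ft t0) (Ft t)].

Definition extendible_along (R : realType) (psi : R -> oct R) (F : element R) :
    Prop :=
  exists Ft : R -> element R, extension_along psi F Ft.

Definition extension_result (R : realType) (psi : R -> oct R) (F G : element R) :
    Prop :=
  exists Ft : R -> element R,
    extension_along psi F Ft /\ same_element (Ft 1) G.

Definition path_in (R : realType) (T : topologicalType) (U : set T)
    (psi : R -> T) : Prop :=
  {within `[0, 1], continuous psi} /\ forall t, `[0, 1]%classic t -> U (psi t).

(* gamma p t is the point of parameter t of the path gamma_p. *)
Definition path_homotopy (R : realType) (T : topologicalType) (U : set T)
    (gamma : R -> R -> T) : Prop :=
  [/\ {within `[0, 1] `*` `[0, 1], continuous (fun x : R * R => gamma x.1 x.2)},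
      forall p t, `[0, 1]%classic p -> `[0, 1]%classic t -> U (gamma p t),
      forall p, `[0, 1]%classic p -> gamma p 0 = gamma 0 0
    & forall p, `[0, 1]%classic p -> gamma p 1 = gamma 0 1].

Definition path_connected (R : realType) (T : topologicalType) (U : set T) :
    Prop :=
  forall x y, U x -> U y ->
    exists psi : R -> T, [/\ path_in U psi, psi 0 = x & psi 1 = y].

Definition cube (R : realType) (k : nat) : set 'rV[R]_k :=
  [set x | forall i, `[0, 1]%classic (x ord0 i)].

Definition cube_boundary (R : realType) (k : nat) : set 'rV[R]_k :=
  [set x | cube x /\ exists i, x ord0 i = 0 \/ x ord0 i = 1].

(* Representatives of the elements of pi_k(U, x0). *)
Definition spheroid (R : realType) (T : topologicalType) (U : set T) (x0 : T)
    (k : nat) (f : 'rV[R]_k -> T) : Prop :=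
  [/\ {within @cube R k, continuous f},
      forall x, cube x -> U (f x)
    & forall x, cube_boundary x -> f x = x0].

Definition spheroid_homotopic (R : realType) (T : topologicalType) (U : set T)
    (x0 : T) (k : nat) (f g : 'rV[R]_k -> T) : Prop :=
  exists H : R -> 'rV[R]_k -> T,
    [/\ {within `[0, 1] `*` @cube R k,
           continuous (fun x : R * 'rV[R]_k => H x.1 x.2)},
        forall s, `[0, 1]%classic s -> spheroid U x0 (H s),
        forall x, cube x -> H 0 x = f x
      & forall x, cube x -> H 1 x = g x].

(* pi_k(U, x0) consists of a single class. *)
Definition trivial_homotopy_group (R : realType) (T : topologicalType)
    (U : set T) (x0 : T) (k : nat) : Prop :=
  forall f g : 'rV[R]_k -> T, spheroid U x0 f -> spheroid U x0 g ->
    spheroid_homotopic U x0 f g.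

Definition k_connected (R : realType) (T : topologicalType) (n : nat)
    (U : set T) : Prop :=
  path_connected R U /\
  forall k, (1 <= k <= n)%N -> forall x0, U x0 ->
    trivial_homotopy_group R U x0 k.

Definition is_domain (T : topologicalType) (U : set T) : Prop :=
  open U /\ connected U.

(* Main.v *)
Require Import Defs.
From mathcomp Require Import all_boot all_order all_algebra finmap.
From mathcomp Require Import all_classical all_reals all_analysis.
From mathcomp Require summability.
From mathcomp Require Import ring lra.

(** Monodromy rests on an identity theorem for elements: if three balls share a
    point and the functions of the first two and of the last two agree on common
    domains, then so do the first and the third ([coherent_trans]).

    The identity theorem comes from the multiplicativity of the octonion norm.
    A bracketed term [b_1 w^k_1 ... b_m w^k_m] has norm
    [|b_1| ... |b_m| |w|^(k_1 + ... + k_m)], whatever the bracketing, so its norm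
    depends on [|w|] alone. Unconditional convergence in a finite-dimensional space
    is absolute; hence convergence at one point of norm [rho] is absolute and
    uniform on the closed ball of radius [rho]. On a line [a + t v] each term is a
    polynomial in [t] whose coefficients are, again by multiplicativity, dominated
    by the term at a point of norm [|a| + t |v|] ([majorized_psterm]). The function
    of an element is therefore real analytic along every segment of its ball, not
    only along rays from the centre ([expansion_analytic]), and one real variable
    suffices ([analytic_segment_vanish]). Two elements with the same centre that
    agree near it are the same, since their balls are maximal
    ([coherent_same_element]).

    While a path stays in the ball of one element, any family along the path which
    starts coherent with that element remains so ([extension_in_elball]). Covering
    a path [gamma p] by balls of a family along it shows that the families along
    all sufficiently close paths, including [gamma p] itself, have the same result
    ([homotopy_locally_constant]). Hence the result is locally constant in [p], and
    it is constant because [0, 1] is connected. *)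

Set Implicit Arguments.
Unset Strict Implicit.
Unset Printing Implicit Defensive.

Import Order.TTheory GRing.Theory Num.Theory.
Import numFieldNormedType.Exports.

Local Open Scope classical_set_scope.
Local Open Scope ring_scope.

(** * Unconditional summation of real families *)

Section Sums.
Variables (R : realType) (I : choiceType).
Implicit Types (a b : I -> R) (A B : {fset I}) (l m c M N : R).

Definition sums_to a (l : R) :=
  summability.partial_sum a B @[B --> summability.totally] --> l.
Definition abs_bounded a M := forall A, \sum_(i <- A) `|a i| <= M.

Lemma partial_sumE (V : zmodType) (a : I -> V) A :
  summability.partial_sum a A = \sum_(i <- A) a i.
Proof. by rewrite /summability.partial_sum big_seq_fsetE. Qed.

Lemma sums_toP a l : sums_to a l <->
  forall e, 0 < e -> exists A0, forall A, (A0 `<=` A)%fset ->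
    `|l - \sum_(i <- A) a i| < e.
Proof.
have FF := @summability.totally_filter I.
split.
  move=> /cvgrPdist_lt H e e0; have [A0 _ HA] := H _ e0.
  by exists A0 => A /HA /=; rewrite partial_sumE.
move=> H; apply/cvgrPdist_lt => e /H[A0 HA].
by exists A0 => // A /= /HA; rewrite partial_sumE.
Qed.

Lemma big_fset_sub_split a A B : (A `<=` B)%fset ->
  \sum_(i <- B) a i = \sum_(i <- A) a i + \sum_(i <- (B `\` A)%fset) a i.
Proof.
move=> AB; rewrite (big_fsetID _ (mem A)) /=; congr (_ + _).
  by apply: eq_fbigl => i; rewrite !inE /= -(@in_fsetI _ B A) (fsetIidPr _).
by apply: eq_fbigl => i; rewrite !inE /= andbC.
Qed.

Lemma sums_to_unique a l l' : sums_to a l -> sums_to a l' -> l = l'.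
Proof.
by have FF := @summability.totally_filter I; apply: (@cvg_unique _ (@Rhausdorff R)).
Qed.

Lemma eq_sums_to a b l : a =1 b -> sums_to a l -> sums_to b l.
Proof. by move=> /funext ->. Qed.

Lemma sums_to_lin a b l m c : sums_to a l -> sums_to b m ->
  sums_to (fun i => a i + c * b i) (l + c * m).
Proof.
have FF := @summability.totally_filter I => Ha Hb.
rewrite /sums_to.
under eq_fun do rewrite partial_sumE big_split -mulr_sumr -!partial_sumE.
by apply: cvgD => //; apply: cvgMr.
Qed.

Arguments sums_to_lin {a b l m} c.

Lemma sums_to_bound a l M : abs_bounded a M -> sums_to a l -> `|l| <= M.
Proof.
move=> HM /sums_toP H; apply/ler_addgt0Pr => e /H[A0 /(_ _ (fsubset_refl _)) HA].
have := le_trans (ler_norm_sum _ _ _) (HM A0).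
have := ler_normD (l - \sum_(i <- A0) a i) (\sum_(i <- A0) a i).
by rewrite subrK; lra.
Qed.

Lemma abs_boundedW a b M : (forall i, `|a i| <= `|b i|) ->
  abs_bounded b M -> abs_bounded a M.
Proof. by move=> ab Hb A; apply: le_trans (Hb A); apply: ler_sum => i _. Qed.

Lemma abs_bounded_add a b M N : abs_bounded a M -> abs_bounded b N ->
  abs_bounded (fun i => `|a i| + `|b i|) (M + N).
Proof.
move=> Ha Hb A; under eq_bigr do rewrite ger0_norm ?addr_ge0//.
by rewrite big_split lerD.
Qed.

Lemma abs_boundedZ a c M : 0 <= c -> abs_bounded a M ->
  abs_bounded (fun i => c * a i) (c * M).
Proof.
move=> c0 Ha A; under eq_bigr do rewrite normrM (ger0_norm c0).
by rewrite -mulr_sumr ler_wpM2l.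
Qed.

(** A nonnegative family sums to the supremum of its finite sums; the general
    case follows from [a = (`|a| + a) - `|a|]. *)
Lemma abs_bounded_sums_to a M : abs_bounded a M -> exists l, sums_to a l.
Proof.
suff pos b N : (forall i, 0 <= b i) -> abs_bounded b N -> exists l, sums_to b l.
  move=> Ha.
  have [||l Hl] := pos (fun i => `|a i|) M; first by [].
    by apply: (abs_boundedW _ Ha) => k; rewrite normr_id.
  have [||m Hm] := pos (fun i => `|a i| + a i) (M + M).
  - by move=> i; have := ler_norm (- a i); rewrite normrN; lra.
  - apply: (abs_boundedW _ (abs_bounded_add Ha Ha)) => i.
    rewrite [leRHS]ger0_norm ?addr_ge0//.
    by apply: le_trans (ler_normD _ _) _; rewrite normr_id.
  exists (m + (-1) * l); apply: (eq_sums_to _ (sums_to_lin (-1) Hm Hl)) => i /=; ring.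
move=> b0 Hb; pose S := [set \sum_(i <- A) b i | A in [set: {fset I}]].
have Sub : has_ubound S.
  exists N => _ [A _ <-]; apply: le_trans (Hb A); apply: ler_sum => i _.
  exact: ler_norm.
have Ssup : has_sup S by split=> //; exists (\sum_(i <- fset0) b i), fset0.
exists (sup S); apply/sums_toP => e e0.
have [_ [A0 _ <-] H] := sup_adherent e0 Ssup.
exists A0 => A AA0; have := big_fset_sub_split b AA0.
have : 0 <= \sum_(i <- (A `\` A0)%fset) b i by apply: sumr_ge0.
have : \sum_(i <- A) b i <= sup S by apply: ub_le_sup => //; exists A.
by move=> ? ? ?; rewrite ger0_norm; lra.
Qed.

(** Finite sums disjoint from some finite [A0] are at most 2. Applied
    separately to the indices with [0 <= a i] and to those with [a i < 0], this
    bounds the sums of [`|a i|]: convergence along finite sets is absolute. *)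
Lemma sums_to_abs_bounded a l : sums_to a l -> exists M, abs_bounded a M.
Proof.
move=> /sums_toP /(_ 1 ltr01)[A0 HA].
have tail B : (B `&` A0 = fset0)%fset -> `|\sum_(i <- B) a i| <= 2.
  move=> BA; have sub : (A0 `<=` A0 `|` B)%fset by apply: fsubsetUl.
  have E : ((A0 `|` B) `\` A0 = B)%fset.
    rewrite fsetDUl fsetDv fset0U; apply/fsetDidPl.
    by rewrite /fdisjoint BA.
  have := big_fset_sub_split a sub; rewrite E.
  have := HA _ (fsubset_refl _); have := HA _ sub.
  set x := \sum_(i <- (A0 `|` B)%fset) _; set y := \sum_(i <- A0) _.
  move=> /ltW; rewrite ler_norml => /andP[? ?] /ltW.
  by rewrite !ler_norml => /andP[? ?] ?; apply/andP; split; lra.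
exists (4 + \sum_(i <- A0) `|a i|) => A.
rewrite (big_fsetID _ (mem A0)) /= addrC lerD//; last first.
  have sub : ([fset x in A | x \in A0] `<=` A0)%fset.
    by apply/fsubsetP => x; rewrite !inE /= => /andP[].
  by rewrite (big_fset_sub_split _ sub) lerDl sumr_ge0.
rewrite (big_fsetID _ (fun i => 0 <= a i)) /=.
set P := [fset x in _ | 0 <= _]%fset; set N := [fset x in _ | ~~ (0 <= _)]%fset.
have -> : \sum_(i <- P) `|a i| = \sum_(i <- P) a i.
  rewrite big_seq [RHS]big_seq; apply: eq_bigr => i; rewrite !inE => /andP[_].
  exact: ger0_norm.
have -> : \sum_(i <- N) `|a i| = - \sum_(i <- N) a i.
  rewrite -sumrN big_seq [RHS]big_seq; apply: eq_bigr => i; rewrite !inE => /andP[_].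
  by rewrite -ltNge => /ltr0_norm.
have dis (B : {fset I}) :
    (B `<=` [fset x in A | x \notin A0])%fset -> (B `&` A0 = fset0)%fset.
  move=> /fsubsetP H; apply/fsetP => x; rewrite !inE; apply/negbTE/negP => /andP[/H].
  by rewrite !inE /= => /andP[_ /negbTE ->].
have PA : (P `<=` [fset x in A | x \notin A0])%fset.
  by apply/fsubsetP => x; rewrite !inE /= => /andP[].
have NA : (N `<=` [fset x in A | x \notin A0])%fset.
  by apply/fsubsetP => x; rewrite !inE /= => /andP[].
have := tail N (dis _ NA); have := tail P (dis _ PA).
by rewrite !ler_norml => /andP[? ?] /andP[? ?]; lra.
Qed.

End Sums.

Arguments sums_to_lin {R I a b l m} c.

(** * The Euclidean norm of the octonions *)

Section OctonionNorm.
Variable R : realType.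
Implicit Types (x y z w : oct R) (s t : R).

Definition cd_dot (A : Type) (d : A -> A -> R) (x y : A * A) : R :=
  d x.1 y.1 + d x.2 y.2.

(** The Euclidean inner product of R^8, doubled in the same way as the algebra.
    The functionals [odot ^~ y] reduce octonionic statements to real ones. *)
Definition odot : oct R -> oct R -> R := cd_dot (cd_dot (cd_dot *%R)).

Ltac ocoords := rewrite /onorm /odot /cd_dot /cd_sqnorm /omul /quat_mul
  /quat_conj /cplx_mul /cplx_conj /cd_mul /cd_conj /=.

Ltac osplit x := case: x => [[[? ?] [? ?]] [[? ?] [? ?]]].

Ltac oring := rewrite /GRing.scale /=;
  congr (((_, _), (_, _)), ((_, _), (_, _))) => /=;
  rewrite /GRing.scale /=; ring.

Lemma onormE x : onorm x = Num.sqrt (odot x x).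
Proof. by []. Qed.

Lemma odotC x y : odot x y = odot y x.
Proof. by ocoords; ring. Qed.

Lemma odotDl x y z : odot (x + y) z = odot x z + odot y z.
Proof. by ocoords; ring. Qed.

Lemma odotZl s x y : odot (s *: x) y = s * odot x y.
Proof. by ocoords; rewrite /GRing.scale /=; ring. Qed.

Lemma odot0l y : odot 0 y = 0.
Proof. by ocoords; ring. Qed.

Lemma odotNl x y : odot (- x) y = - odot x y.
Proof. by ocoords; ring. Qed.

Lemma odot_ge0 x : 0 <= odot x x.
Proof. by ocoords; rewrite -!expr2 !addr_ge0// sqr_ge0. Qed.

Lemma odot_eq0 x : odot x x = 0 -> x = 0.
Proof.
osplit x; ocoords; rewrite -!expr2 => /eqP.
rewrite !paddr_eq0 ?addr_ge0 ?sqr_ge0// !sqrf_eq0.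
by move=> /andP[/andP[/andP[/eqP-> /eqP->] /andP[/eqP-> /eqP->]]
  /andP[/andP[/eqP-> /eqP->] /andP[/eqP-> /eqP->]]].
Qed.

(** Degen's eight-square identity. *)
Lemma odot_omul x y : odot (omul x y) (omul x y) = odot x x * odot y y.
Proof. by osplit x; osplit y; ocoords; ring. Qed.

Lemma omulDl x y z : omul (x + y) z = omul x z + omul y z.
Proof. by osplit x; osplit y; osplit z; ocoords; oring. Qed.

Lemma omulDr x y z : omul z (x + y) = omul z x + omul z y.
Proof. by osplit x; osplit y; osplit z; ocoords; oring. Qed.

Lemma omulZl s x y : omul (s *: x) y = s *: omul x y.
Proof. by osplit x; osplit y; ocoords; oring. Qed.

Lemma omulZr s x y : omul x (s *: y) = s *: omul x y.
Proof. by osplit x; osplit y; ocoords; oring. Qed.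

Lemma omul0l y : omul 0 y = 0.
Proof. by osplit y; ocoords; oring. Qed.

Lemma omul0r x : omul x 0 = 0.
Proof. by osplit x; ocoords; oring. Qed.

Lemma onorm_ge0 x : 0 <= onorm x.
Proof. exact: sqrtr_ge0. Qed.

Lemma onorm_sqr x : onorm x ^+ 2 = odot x x.
Proof. by rewrite onormE sqr_sqrtr ?odot_ge0. Qed.

Lemma onorm_omul x y : onorm (omul x y) = onorm x * onorm y.
Proof. by rewrite !onormE odot_omul sqrtrM ?odot_ge0. Qed.

Lemma onormZ s x : onorm (s *: x) = `|s| * onorm x.
Proof.
by rewrite !onormE odotZl odotC odotZl mulrA -expr2 sqrtrM ?sqr_ge0// sqrtr_sqr.
Qed.

Lemma onorm0 : onorm (0 : oct R) = 0.
Proof. by rewrite onormE odot0l sqrtr0. Qed.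

Lemma onorm1 : onorm (oone R) = 1.
Proof. by rewrite onormE /oone; ocoords; rewrite !(mulr0, mulr1, addr0) sqrtr1. Qed.

(** Cauchy-Schwarz, from the vector [odot x x *: y - odot x y *: x] having a
    nonnegative square. *)
Lemma odot_le x y : `|odot x y| <= onorm x * onorm y.
Proof.
rewrite -ler_sqr ?nnegrE ?mulr_ge0 ?onorm_ge0// exprMn !onorm_sqr real_normK ?num_real//.
have [/odot_eq0->|x0] := eqVneq (odot x x) 0.
  by rewrite !odot0l expr0n mul0r.
have {}x0 : 0 < odot x x by rewrite lt_def x0 odot_ge0.
have := odot_ge0 (odot x x *: y - odot x y *: x).
rewrite odotDl odotNl !odotZl 2!(odotC _ (_ - _)) !odotDl !odotNl !odotZl (odotC y x).
set a := odot x x; set b := odot x y; set c := odot y y.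
have -> : a * (a * c - b * b) - b * (a * b - b * a) = a * (a * c - b ^+ 2) by ring.
by rewrite pmulr_rge0// subr_ge0.
Qed.

Lemma ler_onormD x y : onorm (x + y) <= onorm x + onorm y.
Proof.
rewrite -ler_sqr ?nnegrE ?addr_ge0 ?onorm_ge0// onorm_sqr sqrrD !onorm_sqr.
rewrite odotDl 2!(odotC _ (_ + _)) !odotDl (odotC y x).
by have := odot_le x y; rewrite ler_norml => /andP[_]; lra.
Qed.

Lemma ler_onorm_distD z x y : onorm (x - y) <= onorm (x - z) + onorm (z - y).
Proof. by rewrite -[x - y](subrKA z) ler_onormD. Qed.

Definition obasis : seq (oct R) :=
  [:: (((1, 0), (0, 0)), ((0, 0), (0, 0))); (((0, 1), (0, 0)), ((0, 0), (0, 0)));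
      (((0, 0), (1, 0)), ((0, 0), (0, 0))); (((0, 0), (0, 1)), ((0, 0), (0, 0)));
      (((0, 0), (0, 0)), ((1, 0), (0, 0))); (((0, 0), (0, 0)), ((0, 1), (0, 0)));
      (((0, 0), (0, 0)), ((0, 0), (1, 0))); (((0, 0), (0, 0)), ((0, 0), (0, 1)))].

(** Bounds the norm by finitely many real functionals, so that real absolute
    summability transfers to octonion-valued families. *)
Lemma onorm_le_coords x : onorm x <= \sum_(e <- obasis) `|odot x e|.
Proof.
have exp : x = \sum_(e <- obasis) odot x e *: e.
  by rewrite !big_cons big_nil; osplit x; ocoords; oring.
rewrite [in leLHS]exp.
have: all (fun e => onorm e <= 1) obasis.
  by rewrite /= !onormE; ocoords; rewrite !(mulr0, mulr1, addr0, add0r) sqrtr1 lexx.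
elim: obasis => [|e s IH] /=; first by rewrite !big_nil onorm0.
move=> /andP[e1 /IH H]; rewrite !big_cons (le_trans (ler_onormD _ _))// lerD//.
by rewrite onormZ ler_piMr.
Qed.

Lemma onorm_continuous : continuous (@onorm R).
Proof.
have dbl (A : topologicalType) (q : A -> R) : continuous q -> continuous (cd_sqnorm q).
  move=> cq x; apply: cvgD.
    exact: (continuous_comp (@cvg_fst _ _ _ _ _) (cq x.1)).
  exact: (continuous_comp (@cvg_snd _ _ _ _ _) (cq x.2)).
move=> x; apply: (continuous_comp _ (@sqrt_continuous R _)).
by do 3![apply: (@dbl)]; move=> ?; exact: exprn_continuous.
Qed.

Lemma odot_continuous y : continuous (odot ^~ y).
Proof.
have dbl (A : topologicalType) (d : A -> A -> R) : (forall u, continuous (d ^~ u)) ->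
    forall u, continuous (cd_dot d ^~ u).
  move=> cq u x; apply: cvgD.
    exact: (continuous_comp (@cvg_fst _ _ _ _ _) (cq u.1 x.1)).
  exact: (continuous_comp (@cvg_snd _ _ _ _ _) (cq u.2 x.2)).
by do 3![apply: (@dbl) => ?]; exact: mulrr_continuous.
Qed.

End OctonionNorm.

(** * Series of real polynomials with summable majorants *)

Section Monomials.
Variable R : realType.
Implicit Types (L : seq (nat * R)) (x s r : R).

(** A list of pairs [(i, c)] stands for the polynomial of terms [c x^i], not
    necessarily collected by degree. [mono_tail n L x] is its value at [x] after
    removal of the terms of degree below [n] and division by [x^n]; for [n = 0]
    it is the value of the polynomial. *)
Definition mono_tail n L x : R := \sum_(m <- L | (n <= m.1)%N) x ^+ (m.1 - n) * m.2.

Definition mono_maj r L : R := \sum_(m <- L) r ^+ m.1 * `|m.2|.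

Lemma mono_tailS n L x :
  mono_tail n L x = mono_tail n L 0 + x * mono_tail n.+1 L x.
Proof.
rewrite /mono_tail; elim: L => [|[i c] L IH]; first by rewrite !big_nil mulr0 addr0.
rewrite !big_cons /=; case: ltngtP => [ni|_|<-]; rewrite ?IH.
- have -> : (i - n = (i - n.+1).+1)%N by rewrite subnS prednK ?subn_gt0.
  by rewrite expr0n exprS /=; ring.
- by [].
- by rewrite subnn !expr0; ring.
Qed.

Lemma mono_tail_le n L x r : 0 < r -> `|x| <= r ->
  r ^+ n * `|mono_tail n L x| <= mono_maj r L.
Proof.
move=> r0 xr; rewrite -[r ^+ n]ger0_norm ?exprn_ge0 ?(ltW r0)// -normrM /mono_tail mulr_sumr.
apply: le_trans (ler_norm_sum _ _ _) _.
rewrite /mono_maj big_mkcond; apply: ler_sum => m _; case: ifP => [nm|_]; last first.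
  by rewrite mulr_ge0// exprn_ge0 ?(ltW r0).
rewrite !normrM !normrX mulrA ler_wpM2r// (gtr0_norm r0).
rewrite -{2}(subnKC nm) exprD ler_wpM2l ?exprn_ge0 ?(ltW r0)//.
by rewrite lerXn2r ?nnegrE// ltW.
Qed.

Lemma mono_maj_ge0 r L : 0 <= r -> 0 <= mono_maj r L.
Proof. by move=> r0; apply: sumr_ge0 => m _; rewrite mulr_ge0// exprn_ge0. Qed.

Lemma mono_maj_mono r s L : 0 <= r -> r <= s -> mono_maj r L <= mono_maj s L.
Proof.
move=> r0 rs; apply: ler_sum => m _.
by rewrite ler_wpM2r// lerXn2r ?nnegrE// (le_trans r0).
Qed.

Section Identity.
Variables (I : choiceType) (L : I -> seq (nat * R)) (r M : R).
Hypothesis r0 : 0 < r.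
Hypothesis HM : abs_bounded (fun k => mono_maj r (L k)) M.

Let tail_bounded n x : `|x| <= r ->
  abs_bounded (fun k => r ^+ n * mono_tail n (L k) x) M.
Proof.
move=> xr; apply: (abs_boundedW _ HM) => k.
rewrite normrM normrX (gtr0_norm r0) (ger0_norm (mono_maj_ge0 _ _)) ?(ltW r0)//.
exact: mono_tail_le.
Qed.

Let tail_sums n x : `|x| <= r ->
  exists2 l, sums_to (fun k => mono_tail n (L k) x) l & r ^+ n * `|l| <= M.
Proof.
move=> xr; have rn0 : r ^+ n != 0 by rewrite expf_neq0// gt_eqF.
have [l Hl] := abs_bounded_sums_to (tail_bounded n xr).
have zero : sums_to (fun k : I => 0) (0 : R).
  by apply/sums_toP => e e0; exists fset0 => A _; rewrite big1// subrr normr0.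
exists (0 + (r ^+ n)^-1 * l).
  by apply: (eq_sums_to _ (sums_to_lin (r ^+ n)^-1 zero Hl)) => k; rewrite add0r mulKf.
rewrite add0r normrM normfV normrX (gtr0_norm r0) mulrA divff// mul1r.
exact: sums_to_bound (tail_bounded n xr) Hl.
Qed.

Let tail_shift n x l0 l : sums_to (fun k => mono_tail n (L k) 0) l0 ->
  sums_to (fun k => mono_tail n.+1 (L k) x) l ->
  sums_to (fun k => mono_tail n (L k) x) (l0 + x * l).
Proof.
move=> H0 Hl; apply: (eq_sums_to _ (sums_to_lin x H0 Hl)) => k.
by rewrite [RHS]mono_tailS.
Qed.

(** Identity principle at the centre of expansion. If the sums
    [h_n x] of the [n]-th tails vanish for [x < 0], then
    [`|h_n 0| = `|x h_(n+1) x| <= `|x| M / r^(n+1)] for all small [x < 0], hence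
    [h_n 0 = 0] and [h_(n+1)] vanishes for [x < 0] as well. So all the [h_n 0]
    vanish, [h_0 x = x^n h_n x] is at most [(`|x| / r)^n M], and this tends to
    zero. *)
Lemma mono_series_identity :
  (forall x, - r < x < 0 -> sums_to (fun k => mono_tail 0 (L k) x) 0) ->
  forall x, `|x| < r -> sums_to (fun k => mono_tail 0 (L k) x) 0.
Proof.
move=> H.
have M0 : 0 <= M.
  by have := HM fset0; rewrite big_seq_fset0.
have inr x : - r < x < 0 -> `|x| <= r.
  by move=> /andP[rx x0]; rewrite ltr0_norm//; lra.
have E n : (forall x, - r < x < 0 -> sums_to (fun k => mono_tail n (L k) x) 0) /\
    sums_to (fun k => mono_tail n (L k) 0) 0.
  have step m : (forall x, - r < x < 0 -> sums_to (fun k => mono_tail m (L k) x) 0) ->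
      sums_to (fun k => mono_tail m (L k) 0) 0.
    move=> Hm; have [|l0 Hl0 _] := @tail_sums m 0; first by rewrite normr0 ltW.
    suff l00 : l0 = 0 by rewrite l00 in Hl0.
    have bd x : - r < x < 0 -> r ^+ m.+1 * `|l0| <= `|x| * M.
      move=> xr; have [l Hl lM] := tail_sums m.+1 (inr _ xr).
      have x0 : x != 0 by case/andP: xr => _ /lt_eqF ->.
      have := sums_to_unique (Hm _ xr) (tail_shift Hl0 Hl) => /esym/eqP.
      rewrite addr_eq0 => /eqP ->; rewrite normrN normrM mulrCA ler_wpM2l//.
    apply/eqP; rewrite -normr_le0 leNgt; apply/negP => l00.
    (* [x] small enough to make [x * M < c], against [bd] at [- x] *)
    pose c := r ^+ m.+1 * `|l0|; have c0 : 0 < c by rewrite mulr_gt0 ?exprn_gt0.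
    pose x := Num.min (r / 2) (c / (2 * (M + 1))).
    have x0 : 0 < x by rewrite lt_min !divr_gt0//; lra.
    have xr : x <= r / 2 by rewrite ge_min lexx.
    have := bd (- x); rewrite normrN (gtr0_norm x0) -/c => cx.
    have {cx} : c <= x * M by apply: cx; lra.
    have : x * (2 * (M + 1)) <= c by rewrite -ler_pdivlMr ?ge_min ?lexx ?orbT//; lra.
    by lra.
  elim: n => [|n [IH IH0]]; first by split; [exact: H|exact: step].
  have HS x : - r < x < 0 -> sums_to (fun k => mono_tail n.+1 (L k) x) 0.
    move=> xr; have [l Hl _] := tail_sums n.+1 (inr _ xr).
    have x0 : x != 0 by case/andP: xr => _ /lt_eqF ->.
    have := sums_to_unique (IH _ xr) (tail_shift IH0 Hl) => /esym/eqP.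
    by rewrite add0r mulf_eq0 (negbTE x0) => /eqP l0; rewrite l0 in Hl.
  by split=> //; exact: step.
move=> x xr; have [l Hl _] := tail_sums 0 (ltW xr).
have iterl n : exists2 ln, l = x ^+ n * ln & sums_to (fun k => mono_tail n (L k) x) ln.
  elim: n => [|n [ln lE Hln]]; first by exists l; rewrite ?expr0 ?mul1r.
  have [m Hm _] := tail_sums n.+1 (ltW xr); exists m => //.
  rewrite lE (sums_to_unique Hln (tail_shift (E n).2 Hm)) add0r exprSr mulrA.
  by [].
have bd n : `|l| <= (`|x| / r) ^+ n * M.
  have [ln -> Hln] := iterl n; have [m Hm mM] := tail_sums n (ltW xr).
  rewrite (sums_to_unique Hln Hm) normrM normrX expr_div_n -mulrA ler_wpM2l//.
  by rewrite ler_pdivlMl ?exprn_gt0.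
suff l0 : l = 0 by rewrite l0 in Hl.
apply/eqP; rewrite -normr_le0.
have q1 : `| `|x| / r| < 1.
  by rewrite normrM normr_id normfV (gtr0_norm r0) ltr_pdivrMr// mul1r.
have cv : (fun n => (`|x| / r) ^+ n * M) @ \oo --> (0 * M : R).
  by apply: cvgMl; exact: cvg_expr.
by rewrite -(mul0r M); apply: (cvgr_to_ge cv); apply: nearW => n; exact: bd.
Qed.
End Identity.
End Monomials.

(** * Identity theorem on a segment *)

Section Analytic.
Variables (R : realType) (I : choiceType).
Implicit Types (h : R -> R) (s r : R).

(** Real analyticity, with the series near [s0] indexed by [I] as an octonionic
    expansion is, and not by degree: a sum of polynomials with summable
    majorants. *)
Definition analytic_at h s0 := exists r (L : I -> seq (nat * R)) M,
  [/\ 0 < r, abs_bounded (fun k => mono_maj r (L k)) M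
    & forall x, `|x| < r -> sums_to (fun k => mono_tail 0 (L k) x) (h (s0 + x))].

Lemma analytic_at_sub h1 h2 s : analytic_at h1 s -> analytic_at h2 s ->
  analytic_at (fun x => h1 x - h2 x) s.
Proof.
move=> [r1 [L1 [M1 [r10 B1 H1]]]] [r2 [L2 [M2 [r20 B2 H2]]]].
pose r := Num.min r1 r2; have r0 : 0 < r by rewrite lt_min r10.
have rr1 : r <= r1 by rewrite ge_min lexx.
have rr2 : r <= r2 by rewrite ge_min lexx orbT.
exists r, (fun k => L1 k ++ [seq (m.1, - m.2) | m <- L2 k]), (M1 + M2); split => //.
  apply: (abs_boundedW _ (abs_bounded_add B1 B2)) => k.
  rewrite [leRHS]ger0_norm ?addr_ge0// {1}/mono_maj big_cat big_map /=.
  under [X in _ + X]eq_bigr do rewrite normrN.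
  rewrite !ger0_norm ?addr_ge0 ?mono_maj_ge0 ?(ltW r10) ?(ltW r20) ?(ltW r0)//.
  by apply: lerD; apply: mono_maj_mono => //; exact: ltW.
move=> x xr; rewrite -mulN1r.
apply: (eq_sums_to _ (sums_to_lin (-1) (H1 x _) (H2 x _))); last 2 first.
- exact: lt_le_trans rr1.
- exact: lt_le_trans rr2.
move=> k; rewrite {3}/mono_tail big_cat big_map /=; congr (_ + _).
rewrite mulr_sumr; apply: eq_bigr => m _ /=; ring.
Qed.

Lemma analytic_at_vanish h s e : analytic_at h s -> 0 < e ->
  (forall x, s - e < x < s -> h x = 0) ->
  exists2 d, 0 < d & forall x, `|x - s| < d -> h x = 0.
Proof.
move=> [r [L [M [r0 B H]]]] e0 he.
pose d := Num.min e r; have d0 : 0 < d by rewrite lt_min e0.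
have de : d <= e by rewrite ge_min lexx.
have dr : d <= r by rewrite ge_min lexx orbT.
have Bd : abs_bounded (fun k => mono_maj d (L k)) M.
  apply: (abs_boundedW _ B) => k.
  by rewrite !ger0_norm ?mono_maj_ge0 ?(ltW r0) ?(ltW d0)// mono_maj_mono ?(ltW d0).
exists d => // x xd.
have := H (x - s) (lt_le_trans xd dr); rewrite subrKC => Hx.
apply: (sums_to_unique Hx); apply: (mono_series_identity d0 Bd) => //.
move=> y /andP[dy y0]; rewrite -(he (s + y)); last by apply/andP; split; lra.
by apply: H; rewrite ltr0_norm; lra.
Qed.

(** Let [T] be the supremum of the [s] such that [h] vanishes on [0, s]. The
    zeros of [h] accumulate at [T] from the left, so [h] vanishes around [T],
    which forces [T = 1]. *)
Lemma analytic_segment_vanish h e :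
  (forall s, 0 <= s <= 1 -> analytic_at h s) -> 0 < e ->
  (forall s, 0 <= s -> s < e -> h s = 0) -> h 1 = 0.
Proof.
move=> A e0 he.
pose S := [set s | 0 <= s <= 1 /\ forall u, 0 <= u <= s -> h u = 0].
have mS s : 0 <= s <= 1 -> (forall u, 0 <= u -> u < s -> h u = 0) ->
    0 < s -> exists2 d, 0 < d & forall x, `|x - s| < d -> h x = 0.
  move=> s01 hs s0; apply: (analytic_at_vanish (A _ s01) s0) => x /andP[? ?].
  by apply: hs; lra.
pose e1 := Num.min (e / 2) 1.
have e10 : 0 < e1 by rewrite lt_min; apply/andP; split; lra.
have e1e : e1 <= e / 2 by rewrite ge_min lexx.
have e11 : e1 <= 1 by rewrite ge_min lexx orbT.
have Se1 : S e1.
  split; first by apply/andP; split; lra.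
  by move=> u /andP[? ?]; apply: he; lra.
have ubS : has_ubound S by exists 1 => s [/andP[]].
have supS : has_sup S by split => //; exists e1.
pose T := sup S.
have Te1 : e1 <= T by apply: ub_le_sup.
have T1 : T <= 1 by apply: ge_sup; [exists e1|move=> s [/andP[]]].
have hT u : 0 <= u -> u < T -> h u = 0.
  move=> u0 uT; have Tu : 0 < T - u by lra.
  have [s [_ Ss] us] := sup_adherent Tu supS.
  by apply: Ss; rewrite u0 /=; move: us; rewrite -/T; lra.
have [||d d0 hd] := mS T _ hT; [by apply/andP; split; lra|by lra|].
have hTd u : 0 <= u -> u < T + d -> h u = 0.
  move=> u0 ud; have [uT|Tu] := ltP u T; first exact: hT.
  by apply: hd; rewrite ger0_norm; lra.
apply: (@hTd 1) => //.
rewrite ltNge; apply/negP => Td1.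
have : S (T + d / 2).
  split; first by apply/andP; split; lra.
  by move=> u /andP[? ?]; apply: hTd; lra.
by move=> /(ub_le_sup ubS); rewrite -/T; lra.
Qed.

End Analytic.

(** * Majorants of octonionic products along a line *)

Section Majorants.
Variable R : realType.
Implicit Types (f g : R -> oct R) (r m s : R) (a v c : oct R).

(** The function [g] is a polynomial in a real variable with octonion
    coefficients, and the sum of the norms of its terms at [r] is at most [m].
    The list of terms need not be collected by degree, which makes the product
    of two polynomials a mere list of all pairs. *)
Definition majorized r g m := exists2 L : seq (nat * oct R),
  forall s, g s = \sum_(p <- L) s ^+ p.1 *: p.2
  & \sum_(p <- L) r ^+ p.1 * onorm p.2 <= m.

Lemma majorized_const r c : majorized r (fun=> c) (onorm c).
Proof.
exists [:: (0%N, c)] => [s|]; first by rewrite big_seq1 expr0 scale1r.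
by rewrite big_seq1 expr0 mul1r.
Qed.

Lemma majorized_line r a v : majorized r (fun s => a + s *: v) (onorm a + r * onorm v).
Proof.
exists [:: (0%N, a); (1%N, v)] => [s|]; rewrite big_cons big_seq1 expr0 expr1 /=.
  by rewrite scale1r.
by rewrite mul1r.
Qed.

(** Multiplicativity of the norm makes majorants multiply, whatever the
    order of the factors and the bracketing. *)
Lemma majorized_omul r f g m n : 0 <= r -> majorized r f m -> majorized r g n ->
  majorized r (fun s => omul (f s) (g s)) (m * n).
Proof.
move=> r0 [L fL Lm] [K gK Kn].
exists [seq ((p.1 + q.1)%N, omul p.2 q.2) | p <- L, q <- K] => [s|].
  rewrite big_allpairs_dep /= fL.
  rewrite (big_morph (fun x => omul x (g s)) (fun x y => omulDl x y (g s))
    (omul0l (g s))).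
  apply: eq_bigr => p _.
  rewrite gK (big_morph (omul _) (fun x y => omulDr x y _) (omul0r _)).
  by apply: eq_bigr => q _; rewrite omulZl omulZr scalerA exprD.
rewrite big_allpairs_dep /=.
have -> : \sum_(p <- L) \sum_(q <- K) r ^+ (p.1 + q.1) * onorm (omul p.2 q.2) =
    (\sum_(p <- L) r ^+ p.1 * onorm p.2) * (\sum_(q <- K) r ^+ q.1 * onorm q.2).
  rewrite mulr_suml; apply: eq_bigr => p _; rewrite mulr_sumr.
  by apply: eq_bigr => q _; rewrite onorm_omul exprD; ring.
have pos (L' : seq (nat * oct R)) : 0 <= \sum_(p <- L') r ^+ p.1 * onorm p.2.
  by apply: sumr_ge0 => p _; rewrite mulr_ge0 ?exprn_ge0 ?onorm_ge0.
by rewrite ler_pM.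
Qed.

Lemma majorized_opow r f c n : 0 <= r -> majorized r f (onorm c) ->
  majorized r (fun s => opow (f s) n) (onorm (opow c n)).
Proof.
move=> r0 fc; elim: n => [|n IH]; first exact: majorized_const.
by rewrite /opow iterS onorm_omul; apply: majorized_omul.
Qed.

(** Both lists are read with default value [oone R]: a position beyond the ends
    contributes the constant 1, which majorizes itself. *)
Lemma majorized_bprod r t (fs : R -> seq (oct R)) (cs : seq (oct R)) : 0 <= r ->
  (forall i, majorized r (fun s => nth (oone R) (fs s) i) (onorm (nth (oone R) cs i))) ->
  majorized r (fun s => bprod t (fs s)) (onorm (bprod t cs)).
Proof.
move=> r0; elim: t fs cs => [|t1 IH1 t2 IH2] fs cs H /=.
  by rewrite -nth0; under eq_fun do rewrite -nth0; exact: H.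
rewrite onorm_omul; apply: majorized_omul => //; [apply: IH1|apply: IH2] => i.
  have [it|ti] := ltnP i (leaves t1).
    by rewrite nth_take//; under eq_fun do rewrite nth_take//.
  rewrite nth_default ?size_take_min ?geq_min ?ti//.
  under eq_fun do rewrite nth_default ?size_take_min ?geq_min ?ti//.
  exact: majorized_const.
by rewrite nth_drop; under eq_fun do rewrite nth_drop.
Qed.

(** By multiplicativity, the norm of a term at [w] depends only on the norm of
    [w]. A term restricted to a line is thus majorized by the norm of the same
    term at any point [c] of norm [onorm a + r * onorm v], where the series is
    known to converge. *)
Lemma majorized_psterm r (S : opseries R) k a v c : 0 <= r ->
  onorm a + r * onorm v = onorm c ->
  majorized r (fun s => psterm S (a + s *: v) k) (onorm (psterm S c k)).
Proof.
move=> r0 avc; apply: majorized_bprod => //.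
elim: (iota _ _) => [|j js IH] [|[|i]] /=; do ?exact: majorized_const; last exact: IH.
by apply: majorized_opow => //; rewrite -avc; exact: majorized_line.
Qed.

End Majorants.

(** * Octonionic expansions are analytic along segments *)

Section Expansions.
Variable R : realType.
Implicit Types (f : oct R -> oct R) (z p q w y : oct R) (r : \bar R) (s : R).

Lemma oball_open z0 r w : oball z0 r w ->
  exists2 e, 0 < e & forall z, onorm (z - w) < e -> oball z0 r z.
Proof.
rewrite /oball /=; case: r => [r| |] /=; last 2 first.
- by exists 1 => // z _; rewrite ltry.
- by rewrite ltNge leNye.
rewrite lte_fin => wr; exists (r - onorm (w - z0)); first by rewrite subr_gt0.
move=> z zw; rewrite lte_fin; have := ler_onorm_distD w z z0; lra.
Qed.

Lemma oball_convex z0 r p q s : oball z0 r p -> oball z0 r q -> 0 <= s <= 1 ->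
  oball z0 r (p + s *: (q - p)).
Proof.
move=> zp zq /andP[s0 s1]; rewrite /oball /=.
have -> : p + s *: (q - p) - z0 = (1 - s) *: (p - z0) + s *: (q - z0).
  have -> : q - p = (q - z0) - (p - z0) by rewrite opprB addrA subrK.
  rewrite addrAC scalerBr scalerBl scale1r; move: (_ *: _) (_ *: _) => u v.
  by rewrite addrCA addrC.
have B : onorm ((1 - s) *: (p - z0) + s *: (q - z0)) <=
    Num.max (onorm (p - z0)) (onorm (q - z0)).
  apply: le_trans (ler_onormD _ _) _; rewrite !onormZ !ger0_norm ?subr_ge0//.
  set a := onorm (p - z0); set b := onorm (q - z0); set m := Num.max a b.
  have am : a <= m by rewrite le_max lexx.
  have bm : b <= m by rewrite le_max lexx orbT.
  have : (1 - s) * a <= (1 - s) * m by rewrite ler_wpM2l ?subr_ge0.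
  have : s * b <= s * m by rewrite ler_wpM2l.
  lra.
apply: le_lt_trans (_ : _ <= (Num.max (onorm (p - z0)) (onorm (q - z0)))%:E)%E _.
  by rewrite lee_fin.
by case: (leP (onorm (p - z0)) (onorm (q - z0))).
Qed.

Lemma partial_sums_odot (a : multiindex -> oct R) (l y : oct R) :
  summability.partial_sum a B @[B --> summability.totally] --> l ->
  sums_to (fun k => odot (a k) y) (odot l y).
Proof.
move=> al; have FF := @summability.totally_filter multiindex.
have E B : summability.partial_sum (fun k => odot (a k) y) B =
    odot (summability.partial_sum a B) y.
  rewrite !partial_sumE.
  by rewrite (big_morph (fun x => odot x y) (fun x z => odotDl x z y) (odot0l y)).
rewrite /sums_to (funext E).
exact: (continuous_cvg _ (@odot_continuous R y l) al).
Qed.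

Arguments partial_sums_odot {a l} y.

Lemma partial_sums_onorm_bounded (a : multiindex -> oct R) (l : oct R) :
  summability.partial_sum a B @[B --> summability.totally] --> l ->
  exists M, abs_bounded (fun k => onorm (a k)) M.
Proof.
move=> al; suff [M HM] : exists M,
    abs_bounded (fun k => \sum_(e <- obasis R) `|odot (a k) e|) M.
  exists M; apply: (abs_boundedW _ HM) => k.
  rewrite !ger0_norm ?onorm_ge0 ?sumr_ge0//; exact: onorm_le_coords.
elim: (obasis R) => [|e es [M IH]].
  by exists 0 => A; rewrite big1// => k _; rewrite big_nil normr0.
have [N HN] := sums_to_abs_bounded (partial_sums_odot e al).
exists (N + M); apply: (abs_boundedW _ (abs_bounded_add HN IH)) => k.
by rewrite big_cons (@ger0_norm _ (\sum_(_ <- _) _)) ?sumr_ge0.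
Qed.

(** Around the point [a] of the segment (relative to the centre), choose [d]
    with [onorm a + d * onorm v] smaller than the radius. The series converges
    absolutely at a point [c] of that norm, and its terms there majorize the
    restrictions of the terms to the line. *)
Lemma expansion_analytic f z0 r p q y s : has_expansion f z0 r ->
  oball z0 r p -> oball z0 r q -> 0 <= s <= 1 ->
  analytic_at multiindex (fun t => odot (f (p + t *: (q - p))) y) s.
Proof.
move=> [S HS] zp zq s01; pose a := p + s *: (q - p) - z0; pose v := q - p.
have az : ((onorm a)%:E < r)%E by exact: oball_convex.
have [d d0 dr] : exists2 d : R, 0 < d & ((onorm a + d * onorm v)%:E < r)%E.
  case: r az {HS zp zq} => [r| |] /=; last 2 first.
  - by exists 1; rewrite ?ltry.
  - by rewrite ltNge leNye.
  rewrite lte_fin => az; have v0 := onorm_ge0 v.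
  (* the summand 1 covers the case [v = 0] *)
  exists ((r - onorm a) / (onorm v + 1)); first by rewrite divr_gt0; lra.
  rewrite lte_fin -ltrBrDl mulrAC ltr_pdivrMr; last by lra.
  by rewrite ltr_pM2l; lra.
pose c : oct R := (onorm a + d * onorm v) *: oone R.
have cn : onorm c = onorm a + d * onorm v.
  by rewrite onormZ onorm1 mulr1 ger0_norm// addr_ge0 ?mulr_ge0 ?onorm_ge0 ?ltW.
have cball : oball z0 r (z0 + c) by rewrite /oball /= addrC addKr cn.
have [M HM] := partial_sums_onorm_bounded (HS _ cball).
rewrite [z0 + c]addrC addrK in HM.
have maj k : exists L : seq (nat * oct R),
    (forall t, psterm S (a + t *: v) k = \sum_(m <- L) t ^+ m.1 *: m.2) /\
    \sum_(m <- L) d ^+ m.1 * onorm m.2 <= onorm (psterm S c k).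
  have [|L H1 H2] := @majorized_psterm R d S k a v c (ltW d0); first by rewrite cn.
  by exists L.
have [L HL] := choice maj.
exists d, (fun k => [seq (m.1, odot m.2 y) | m <- L k]), (onorm y * M); split => //.
  apply: (abs_boundedW _ (abs_boundedZ (onorm_ge0 y) HM)) => k.
  rewrite !ger0_norm ?mono_maj_ge0 ?mulr_ge0 ?onorm_ge0 ?(ltW d0)//.
  apply: le_trans (ler_wpM2l (onorm_ge0 y) (HL k).2).
  rewrite /mono_maj big_map mulr_sumr; apply: ler_sum => m _ /=.
  by rewrite mulrCA [onorm y * _]mulrC ler_wpM2l ?exprn_ge0 ?(ltW d0)// odot_le.
move=> x xd; have E : p + (s + x) *: (q - p) - z0 = a + x *: v.
  by rewrite scalerDl addrA; exact: addrAC.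
have zx : oball z0 r (p + (s + x) *: (q - p)).
  rewrite /oball /= E; apply: le_lt_trans dr.
  rewrite lee_fin; apply: le_trans (ler_onormD _ _) _; rewrite onormZ.
  by rewrite lerD2l ler_wpM2r ?onorm_ge0 ?ltW.
apply: (eq_sums_to _ (partial_sums_odot y (HS _ zx))) => k.
rewrite E (HL k).1 (big_morph (fun x => odot x y) (fun x z => odotDl x z y) (odot0l y)).
rewrite /mono_tail big_map /=; apply: eq_bigr => m _.
by rewrite odotZl subn0.
Qed.

End Expansions.

(** * Coherent elements *)

Section Elements.
Variable R : realType.
Implicit Types (F G H : element R) (p q : oct R).

(** The agreement part of being an immediate extension, also meaningful when the
    balls are disjoint; this is what propagates along paths. *)
Definition coherent F G := forall z, elball F z -> elball G z -> elfun F z = elfun G z.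

Lemma coherent_sym F G : coherent F G -> coherent G F.
Proof. by move=> FG z Gz Fz; rewrite FG. Qed.

Lemma elball_centre F : elball F (elcentre F).
Proof. by case: F => z r f [r0 ? ?]; rewrite /elball /oball /= subrr onorm0. Qed.

Lemma elfun_analytic F p q y s : elball F p -> elball F q -> 0 <= s <= 1 ->
  analytic_at multiindex (fun t => odot (elfun F (p + t *: (q - p))) y) s.
Proof. by case: F => z r f [? ? ?]; exact: expansion_analytic. Qed.

(** Identity theorem for elements. Near [p] all three functions are defined,
    hence [F] and [H] agree there. For [q] in both balls, pairing
    [elfun F - elfun H] with its value at [q] gives a function that is analytic on
    the segment from [p] to [q] and vanishes near [p], hence at [q]. *)
Lemma coherent_trans G F H p : elball F p -> elball G p -> elball H p ->
  coherent F G -> coherent G H -> coherent F H.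
Proof.
move=> Fp Gp Hp FG GH q Fq Hq; apply/eqP; rewrite -subr_eq0; apply/eqP.
set y := elfun F q - elfun H q; apply: odot_eq0.
pose h t := odot (elfun F (p + t *: (q - p))) y - odot (elfun H (p + t *: (q - p))) y.
have [eF eF0 hF] := oball_open Fp.
have [eG eG0 hG] := oball_open Gp.
have [eH eH0 hH] := oball_open Hp.
pose e := Num.min eF (Num.min eG eH).
have e0 : 0 < e by rewrite !lt_min eF0 eG0.
have n0 := onorm_ge0 (q - p).
have <- : h 1 = odot y y by rewrite /h scale1r subrKC -odotNl -odotDl.
apply: (@analytic_segment_vanish R multiindex h (e / (onorm (q - p) + 1))).
- by move=> s s01; apply: analytic_at_sub; exact: elfun_analytic.
- by rewrite divr_gt0//; lra.
move=> s s0 se.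
have : onorm (p + s *: (q - p) - p) < e.
  rewrite addrC addKr onormZ ger0_norm//.
  move: se; rewrite ltr_pdivlMr; last by lra.
  by apply: le_lt_trans; rewrite ler_wpM2l//; lra.
rewrite /e !lt_min => /and3P[sF sG sH].
by rewrite /h FG ?GH ?subrr; do ?[exact: hF|exact: hG|exact: hH].
Qed.

Lemma same_element_sym F G : same_element F G -> same_element G F.
Proof. by case=> c b f; split=> // z; rewrite -b => /f. Qed.

Lemma same_element_trans F G H : same_element F G -> same_element G H -> same_element F H.
Proof.
move=> [c b f] [c' b' f']; split; [by rewrite c|by rewrite b|].
by move=> z Fz; rewrite f// f'// -b.
Qed.

Lemma same_element_coherent F G : same_element F G -> coherent F G.
Proof. by case=> _ _ f z /f. Qed.

(** Otherwise the function of [G] would extend that of [F] to a larger ball, with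
    an expansion there, against the maximality of the ball of [F]. *)
Lemma coherent_radius F G : elcentre F = elcentre G -> coherent F G ->
  (elradius G <= elradius F)%E.
Proof.
case: F G => z r f [r0 E max] [z' r' g [r'0 E' max']] /= zz'.
case: z' / zz' E' max' => E' max' FG.
rewrite leNgt; apply/negP => rr'.
have: ~ has_expansion g z r'; last exact.
apply: (max r' g) => // w zw; apply/esym/FG => //.
by move: zw; rewrite /elball /oball /= => /lt_trans; apply.
Qed.

Lemma coherent_same_element F G : elcentre F = elcentre G -> coherent F G ->
  same_element F G.
Proof.
move=> cFG FG.
have rFG : elradius F = elradius G.
  apply/eqP; rewrite eq_le (coherent_radius cFG FG) andbT.
  by apply: coherent_radius => //; exact: coherent_sym.
have bFG : elball F = elball G by rewrite /elball cFG rFG.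
by split=> // z Fz; apply: FG => //; rewrite -bFG.
Qed.

End Elements.

(** * Propagation along an interval *)

Section Intervals.
Variable R : realType.
Implicit Types (a b s t e d : R) (P Q : R -> Prop).

(** A property that is locally constant on [a, b] defines a subset that is both
    open and closed in the connected set [a, b]. *)
Lemma interval_propagation a b P :
  (forall s, a <= s <= b -> exists2 d, 0 < d &
     forall t, a <= t <= b -> `|t - s| < d -> (P t <-> P s)) ->
  forall s t, a <= s <= b -> a <= t <= b -> P s -> P t.
Proof.
move=> loc s t sab tab Ps.
pose O Q := [set x | exists u d, [/\ a <= u <= b, Q u, `|x - u| < d
  & forall v, a <= v <= b -> `|v - u| < d -> (P v <-> P u)]].
have Oopen Q : open (O Q).
  rewrite openE => x [u [d [uab Qu xu H]]]; apply/nbhs_ballP.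
  exists (d - `|x - u|); first by rewrite /= subr_gt0.
  move=> y; rewrite /ball /= => xy; exists u, d; split => //.
  by have := ler_distD x y u; rewrite (distrC y x); lra.
have OP : [set` `[a, b]] `&` [set x | P x] = [set` `[a, b]] `&` O P.
  apply/seteqP; split => x /= [xab H]; split => //; move: (xab);
    rewrite in_itv /= => xab'.
    have [d d0 Hd] := loc x xab'; exists x, d; split => //.
    by rewrite subrr normr0.
  by have [u [d [uab Pu xu /(_ x xab' xu)[_]]]] := H; apply.
have ON : [set` `[a, b]] `&` [set x | P x] = [set` `[a, b]] `&` ~` O (fun x => ~ P x).
  apply/seteqP; split => x /= [xab H]; split => //; move: (xab);
    rewrite in_itv /= => xab'.
    by move=> [u [d [uab NPu xu /(_ x xab' xu)[Pu _]]]]; apply/NPu/Pu.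
  apply: contrapT => NP; apply: H; have [d d0 Hd] := loc x xab'; exists x, d; split => //.
  by rewrite subrr normr0.
have E : [set` `[a, b]] `&` [set x | P x] = [set` `[a, b]].
  apply: (@segment_connected R a b).
  - by exists s; split => //=; rewrite in_itv.
  - by exists (O P).
  - by exists (~` O (fun x => ~ P x)) => //; exact: open_closedC.
by have [] : ([set` `[a, b]] `&` [set x | P x]) t by rewrite E /= in_itv.
Qed.

End Intervals.

(** * Analytic extension along paths and homotopies *)

Section Extensions.
Variable R : realType.
Implicit Types (psi : R -> oct R) (F G E : element R) (Ft Gt : R -> element R).
Implicit Types (a b s t p d e : R).

Definition continuous_on_unit_at psi s := forall e, 0 < e -> exists2 d, 0 < d &
  forall t, 0 <= t <= 1 -> `|t - s| < d -> onorm (psi t - psi s) < e.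

Lemma nbhs_onorm (w : oct R) e : 0 < e -> nbhs w [set z | onorm (z - w) < e].
Proof.
move=> e0; have : (fun z => onorm (z - w)) @ w --> onorm (w - w).
  apply: (continuous_cvg _ (@onorm_continuous R _)).
  by apply: cvgB; [exact: cvg_id|exact: cvg_cst].
by rewrite subrr onorm0 => /cvgr_lt; apply.
Qed.

Lemma homotopy_continuous_on_unit (U : set (oct R)) (gamma : R -> R -> oct R) p s e :
  path_homotopy U gamma -> 0 <= p <= 1 -> 0 <= s <= 1 -> 0 < e ->
  exists2 d, 0 < d & forall q t, 0 <= q <= 1 -> 0 <= t <= 1 ->
    `|q - p| < d -> `|t - s| < d -> onorm (gamma q t - gamma p s) < e.
Proof.
move=> [/subspace_continuousP cont _ _ _] p01 s01 e0.
have /cont : (`[0, 1] `*` `[0, 1]) (p, s) by split; rewrite /= in_itv.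
move=> /(_ _ (nbhs_onorm _ e0)); rewrite /= /within /= => /nbhs_ballP[d d0 H].
exists d => // q t q01 t01 qp ts; apply: (H (q, t)).
  by split; rewrite /ball /= distrC.
by split; rewrite /= in_itv.
Qed.

Lemma extension_coherent psi F Ft s d : extension_along psi F Ft ->
  0 <= s <= 1 -> 0 < d ->
  (forall t, 0 <= t <= 1 -> `|t - s| < d -> elball (Ft s) (psi t)) ->
  forall t, 0 <= t <= 1 -> `|t - s| < d -> coherent (Ft s) (Ft t).
Proof.
move=> [_ _ H] s01 d0 sd t t01 ts.
have seg u : (`]s - d, s + d[ `&` `[0, 1]) u <-> `|u - s| < d /\ 0 <= u <= 1.
  by rewrite /= !in_itv /= ltr_distl.
have ss : (`]s - d, s + d[ `&` `[0, 1]) s by apply/seg; rewrite subrr normr0.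
have tt : (`]s - d, s + d[ `&` `[0, 1]) t by apply/seg.
have [|_ FF] := H _ _ _ ss _ t tt; first by move=> u /seg[? ?]; exact: sd.
by move=> z Fs Ft'; apply: FF.
Qed.

(** As long as the path stays in the ball of one element [E], the family remains
    coherent with [E]: around [s] it is coherent with [Ft s], and the balls of
    [Ft s], [Ft t] and [E] have the point [psi t] in common. *)
Lemma extension_in_elball psi F Ft E a b : extension_along psi F Ft ->
  (forall s, 0 <= s <= 1 -> continuous_on_unit_at psi s) -> 0 <= a -> b <= 1 ->
  (forall t, a <= t <= b -> elball E (psi t)) ->
  forall s t, a <= s <= b -> a <= t <= b -> coherent (Ft s) E -> coherent (Ft t) E.
Proof.
move=> ext cont a0 b1 Epsi; apply: interval_propagation => s sab.
have in01 u : a <= u <= b -> 0 <= u <= 1 by move=> /andP[? ?]; apply/andP; split; lra.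
have centre u : a <= u <= b -> elball (Ft u) (psi u).
  move=> /in01 u01; have [_ Hc _] := ext; rewrite -Hc; first exact: elball_centre.
  by rewrite /= in_itv.
have s01 := in01 _ sab.
have [e e0 He] := oball_open (centre s sab).
have [d d0 Hd] := cont s s01 e e0.
have near t t01 ts : elball (Ft s) (psi t) := He _ (Hd t t01 ts).
exists d => // t tab ts; have t01 := in01 _ tab.
have st := extension_coherent ext s01 d0 near t01 ts.
have [cs ct] := (near t t01 ts, centre t tab).
split=> H.
  exact: (coherent_trans cs ct (Epsi t tab)).
exact: (coherent_trans ct cs (Epsi t tab) (coherent_sym st)).
Qed.

(** Compare the families along nearby paths with the fixed family [Ft], at one
    parameter [t] after the other: the property propagated from [t = 0] to
    [t = 1] is that every family along a path close enough to [gamma p] is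
    coherent with [Ft] at [t]. Around a parameter [s], all points [gamma q t] lie
    in the ball of the single element [Ft s], which carries the comparison from
    one parameter to another. *)
Lemma homotopy_locally_constant (U : set (oct R)) (gamma : R -> R -> oct R) F p Ft :
  path_homotopy U gamma -> 0 <= p <= 1 -> extension_along (gamma p) F Ft ->
  exists2 d, 0 < d & forall q Gt, 0 <= q <= 1 -> `|q - p| < d ->
    extension_along (gamma q) F Gt -> same_element (Gt 1) (Ft 1).
Proof.
move=> hom p01 extF.
have path q : 0 <= q <= 1 -> forall s, 0 <= s <= 1 -> continuous_on_unit_at (gamma q) s.
  move=> q01 s s01 e e0; have [d d0 H] := homotopy_continuous_on_unit hom q01 s01 e0.
  by exists d => // t t01 ts; apply: H => //; rewrite subrr normr0.
have centre q E Gt t : extension_along (gamma q) E Gt -> 0 <= t <= 1 ->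
    elcentre (Gt t) = gamma q t.
  by move=> [_ + _] t01; apply; rewrite /= in_itv.
have centreb q E Gt t : extension_along (gamma q) E Gt -> 0 <= t <= 1 ->
    elball (Gt t) (gamma q t).
  by move=> ext t01; rewrite -(centre _ _ _ _ ext t01); exact: elball_centre.
have nbd s : 0 <= s <= 1 -> exists2 d, 0 < d & forall q t, 0 <= q <= 1 -> 0 <= t <= 1 ->
    `|q - p| < d -> `|t - s| < d -> elball (Ft s) (gamma q t).
  move=> s01; have [e e0 He] := oball_open (centreb _ _ _ _ extF s01).
  have [d d0 Hd] := homotopy_continuous_on_unit hom p01 s01 e0; exists d => // *.
  by apply: He; apply: Hd.
pose P t := exists2 d, 0 < d & forall q Gt, 0 <= q <= 1 -> `|q - p| < d ->
  extension_along (gamma q) F Gt -> coherent (Gt t) (Ft t).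
have zero : 0 <= (0 : R) <= 1 by rewrite lexx ler01.
have one : 0 <= (1 : R) <= 1 by rewrite lexx ler01.
suff [d d0 Hd] : P 1.
  exists d => // q Gt q01 qp extG; apply: coherent_same_element; last exact: (Hd q).
  rewrite (centre _ _ _ _ extG one) (centre _ _ _ _ extF one).
  by have [_ _ _ g1] := hom; rewrite !g1//= in_itv.
apply: (@interval_propagation R 0 1 P _ 0) => //; last first.
  exists 1 => // q Gt _ _ [FG _ _]; apply: same_element_coherent.
  apply: (same_element_trans (same_element_sym FG)).
  by case: extF.
move=> s s01; have [d d0 Hd] := nbd s s01.
have pp : `|p - p| < d by rewrite subrr normr0.
have near t t01 ts : elball (Ft s) (gamma p t) := Hd p t p01 t01 pp ts.
have Fst := extension_coherent extF s01 d0 near.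
(* [Gt t] is coherent with [Ft t], hence with [Ft s]; along the path [Gt u]
   stays coherent with [Ft s], hence with [Ft u]. *)
have transfer t u : 0 <= t <= 1 -> 0 <= u <= 1 -> `|t - s| < d -> `|u - s| < d ->
    P t -> P u.
  move=> t01 u01 ts us [c c0 Hc].
  have [dt dt0 Hdt] := nbd t t01; have [du du0 Hdu] := nbd u u01.
  pose m := Num.min (Num.min c d) (Num.min dt du).
  exists m => [|q Gt q01]; first by rewrite !lt_min c0 d0 dt0.
  rewrite /m !lt_min => /andP[/andP[qc qd] /andP[qt qu]] extG.
  have Gs : coherent (Gt t) (Ft s).
    apply: (coherent_trans (centreb _ _ _ _ extG t01)) (Hc _ _ q01 qc extG)
      (coherent_sym (Fst t t01 ts)).
      by apply: Hdt => //; rewrite subrr normr0.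
    exact: Hd.
  have {}Gs : coherent (Gt u) (Ft s).
    apply: (@extension_in_elball (gamma q) F Gt (Ft s) (Num.min t u) (Num.max t u)
      extG _ _ _ _ t u) => //.
    - exact: path.
    - by rewrite le_min; case/andP: t01 => ->; case/andP: u01 => ->.
    - by rewrite ge_max; case/andP: t01 => _ ->; case/andP: u01 => _ ->.
    - move=> v; rewrite ge_min le_max => /andP[/orP tv /orP vt].
      move: t01 u01 => /andP[? ?] /andP[? ?]; move: ts us; rewrite !ltr_distl.
      move=> /andP[? ?] /andP[? ?].
      apply: Hd => //; rewrite ?ltr_distl; apply/andP; split; case: tv; case: vt; lra.
    - by rewrite ge_min le_max !lexx.
    - by rewrite ge_min le_max !lexx !orbT.
  apply: (coherent_trans (centreb _ _ _ _ extG u01)) Gs (Fst u u01 us).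
    exact: Hd.
  by apply: Hdu => //; rewrite subrr normr0.
exists d => // t t01 ts; have ss : `|s - s| < d by rewrite subrr normr0.
by split; exact: transfer.
Qed.

(** The results for parameters near [s] all agree with the result of one family
    along [gamma s], which extendibility supplies. *)
Lemma extension_homotopy_invariant (U : set (oct R)) (gamma : R -> R -> oct R) F Ft :
  path_homotopy U gamma ->
  (forall p, `[0, 1]%classic p -> extendible_along (gamma p) F) ->
  extension_along (gamma 0) F Ft ->
  forall p Gt, 0 <= p <= 1 -> extension_along (gamma p) F Gt ->
    same_element (Gt 1) (Ft 1).
Proof.
move=> hom ext extF p Gt p01; move: Gt.
have zero : 0 <= (0 : R) <= 1 by rewrite lexx ler01.
pose P q := forall Gt, extension_along (gamma q) F Gt -> same_element (Gt 1) (Ft 1).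
apply: (@interval_propagation R 0 1 P _ 0) => //; last first.
  have [d d0 H] := homotopy_locally_constant hom zero extF.
  by move=> Gt; apply: H => //; rewrite subrr normr0.
have exq q : 0 <= q <= 1 -> extendible_along (gamma q) F.
  by move=> q01; apply: ext; rewrite /= in_itv.
move=> s s01; have [Hs extH] := exq s s01.
have [d d0 H] := homotopy_locally_constant hom s01 extH.
exists d => // t t01 ts; have [Gs extG] := exq t t01.
split=> Pt Kt extK.
  have := H s Kt s01 _ extK; rewrite subrr normr0 => /(_ d0) KH.
  apply: same_element_trans KH _.
  apply: same_element_trans (same_element_sym (H t Gs t01 ts extG)) _.
  exact: Pt.
by apply: same_element_trans (H t Kt t01 ts extK) (Pt Hs extH).
Qed.

End Extensions.

Theorem theorem45 (R : realType) (U : set (oct R)) (gamma : R -> R -> oct R)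
    (F : element R) :
  is_domain U ->
  k_connected R 7 U ->
  path_homotopy U gamma ->
  (forall p : R, `[0, 1]%classic p -> extendible_along (gamma p) F) ->
  forall G H : element R,
    extension_result (gamma 0) F G \/ extension_result (gamma 1) F G ->
    extension_result (gamma 0) F H \/ extension_result (gamma 1) F H ->
    same_element G H.
Proof.
move=> _ _ hom ext G H HG HH.
have [E0 extE] : extendible_along (gamma 0) F.
  by apply: ext; rewrite /= in_itv /= lexx ler01.
suff same K : extension_result (gamma 0) F K \/ extension_result (gamma 1) F K ->
    same_element K (E0 1).
  exact: (same_element_trans (same _ HG) (same_element_sym (same _ HH))).
have inv := extension_homotopy_invariant hom ext extE.
case=> -[Kt [extK K1]]; apply: (same_element_trans (same_element_sym K1)).
  by apply: (inv 0) => //; rewrite lexx ler01.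
by apply: (inv 1) => //; rewrite lexx ler01.
Qed.
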